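(* Let $\ell$ be a positive integer, $\mathbb{K}$ a field, and let $a_{i,j}\in\mathbb{K}$ ($1\le i\le \ell+1$, $j\in\mathbb{N}_0$) be constants with $a_{\ell,j}\neq 0$ and $a_{\ell+1,j}\neq 0$ for all $j\in\mathbb{N}_0$. Let $(P_n(x))_{n=0}^\infty$ be the polynomials defined by $P_{-1}(x)=0$, $P_n(x)=x^n$ for $n=0,\ldots,\ell-1$, and $$P_n(x)=-\sum_{i=1}^{\ell-1}a_{i,n-\ell}P_{n-i}(x)+(x^{\ell}-a_{\ell,n-\ell})P_{n-\ell}(x)-a_{\ell+1,n-\ell}x^{\ell}P_{n-\ell-1}(x),\qquad n\geq \ell.$$ Let $\mathcal{L}\colon\mathbb{K}[x,x^{-1}]\to\mathbb{K}$ be the unique linear functional such that $(P_n(x))_{n=0}^\infty$ is an $\ell$-LBPs with respect to $\mathcal{L}$ and such that $\mathcal{L}[1]=1$. Then the moments $\mu_n=\mathcal{L}[x^n]$ ($n\in\mathbb{Z}$) are given by $$\mu_n=\begin{cases} a_{\ell,0}\,w(\mathcal{B}_{n-\ell}), & \text{if } n\ge \ell,\\ 0, & \text{if } 1\le n\le \ell-1,\\ (-1)^{n\bmod \ell}\,w(\widetilde{\mathcal{B}}_{-n}), & \text{if } n\le 0.\end{cases}$$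
   Context: $\mathbb{N}_0$ is the set of non-negative integers. For $p\in\mathbb{Z}$ and a positive integer $q$, $p\bmod q\in\{0,\ldots,q-1\}$ is the remainder of dividing $p$ by $q$. A sequence of monic polynomials $(P_n(x))_{n=0}^\infty$ over $\mathbb{K}$, with $P_n$ of exact degree $n$, is an $\ell$-LBPs ($\ell$-Laurent bi-orthogonal polynomials) with respect to a linear functional $\mathcal{L}\colon\mathbb{K}[x,x^{-1}]\to\mathbb{K}$ if there are constants $h_n\ne 0$ with $\mathcal{L}[P_n(x)x^{-k\ell}]=h_n\delta_{n,k}$ for all $n,k\in\mathbb{N}_0$ with $0\le k\le n$. (For the sequence $(P_n)$ of the claim, a functional with this property and $\mathcal{L}[1]=1$ exists and is unique.) Paths. A path is a finite (possibly empty) word over a finite set of steps (integer vectors in the $x$-$y$ plane) together with an initial point in $\mathbb{Z}^2$; it goes from its initial point to its final point (initial point plus the sum of its steps). The weight of a path is the product of the weights of its steps, where the weight of a step may depend on the point $(s,t)$ at which that step starts; the empty path has weight $1$. An $\ell$-Schröder path is a path with steps $\mathsf{a}_i=(i,\ell-i)$ for $i=0,\ldots,\ell$ and $\mathsf{a}_{\ell+1}=(1,-1)$, never going below the $x$-axis. Weights of steps: $w(\mathsf{a}_0,(s,t))=1$ and $w(\mathsf{a}_i,(s,t))=a_{i,t}$ for $i=1,\ldots,\ell+1$. A dual $\ell$-Schröder path is a path with steps $\mathsf{A}_i=(\ell-i,\ell-i)$ for $i=0,\ldots,\ell-1$, $\mathsf{A}_\ell=(\ell,0)$ and $\mathsf{A}_{\ell+1}=(\ell-1,-1)$,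 never going below the $x$-axis. Weights of steps: $w(\mathsf{A}_0,(s,t))=\frac{(-1)^{\ell+1}}{a_{\ell,t}}$; $w(\mathsf{A}_i,(s,t))=\frac{(-1)^{\ell+1+i}a_{i,t}}{a_{\ell,t}}$ for $1\le i\le \ell-1$ and for $i=\ell+1$; $w(\mathsf{A}_\ell,(s,t))=\frac{1}{a_{\ell,t}}$. For $n\in\mathbb{N}_0$, $\mathcal{B}_n$ is the set of $\ell$-Schröder paths from $(0,n\bmod\ell)$ to $(n,0)$, and $\widetilde{\mathcal{B}}_n$ is the set of dual $\ell$-Schröder paths from $(0,(-n)\bmod \ell)$ to $(n,0)$. Put $w(\mathcal{B}_n)=\sum_{\omega\in\mathcal{B}_n}w(\omega)$ and $w(\widetilde{\mathcal{B}}_n)=\sum_{\omega\in\widetilde{\mathcal{B}}_n}w(\omega)$. *)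

(* Defs.v *)
From HB Require Import structures.
From mathcomp Require Import all_boot all_order all_algebra.
From mathcomp Require Import finmap boolp classical_sets functions cardinality.
From mathcomp Require Import fsbigop monalg zify.

Set Implicit Arguments.
Unset Strict Implicit.
Unset Printing Implicit Defensive.

Import Order.TTheory GRing.Theory Num.Theory.

Local Open Scope ring_scope.

(* The Laurent polynomial ring K[x, x^-1]: the free K-module on the monomials  *)
(* x^n, n : int, with the convolution product.  The product of [monalg] is not *)
(* available here, because its [monomType] excludes nontrivial units.          *)
Definition laurent (K : fieldType) : Type := {malg K[int]}.

Section LaurentRing.
Variable K : fieldType.

HB.instance Definition _ := GRing.Lmodule.on (laurent K).

Implicit Types f g : {malg K[int]}.
Local Open Scope fset_scope.
Local Open Scope ring_scope.

Definition laurent_mul f g : {malg K[int]} :=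
  \sum_(i <- msupp f) \sum_(j <- msupp g) << f@_i * g@_j *g i + j >>.

Fact laurent_mulEw (d1 d2 : {fset int}) f g :
  msupp f `<=` d1 -> msupp g `<=` d2 ->
  laurent_mul f g = \sum_(i <- d1) \sum_(j <- d2) << f@_i * g@_j *g i + j >>.
Proof.
move=> le1 le2; rewrite /laurent_mul (big_fset_incl _ le1) /=.
  apply: eq_bigr => i _; apply: big_fset_incl => // j _ /mcoeff_outdom ->.
  by rewrite mulr0 monalgU0.
move=> i _ /mcoeff_outdom fi.
by rewrite big1 // => j _; rewrite fi mul0r monalgU0.
Qed.

Fact laurent_mulC : commutative laurent_mul.
Proof.
move=> f g; rewrite /laurent_mul exchange_big /=.
by apply: eq_bigr => j _; apply: eq_bigr => i _; rewrite mulrC addrC.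
Qed.

Fact laurent_mulUU (c d : K) (i j : int) :
  laurent_mul << c *g i >> << d *g j >> = << c * d *g i + j >>.
Proof.
by rewrite (laurent_mulEw msuppU_le msuppU_le) !big_seq_fset1 !mcoeffUU.
Qed.

Fact laurent_mulDl : left_distributive laurent_mul +%R.
Proof.
move=> f1 f2 g.
rewrite (laurent_mulEw (msuppD_le f1 f2) (fsubset_refl (msupp g))).
rewrite (laurent_mulEw (fsubsetUl (msupp f1) (msupp f2)) (fsubset_refl _)).
rewrite (laurent_mulEw (fsubsetUr (msupp f1) (msupp f2)) (fsubset_refl _)).
rewrite -big_split /=; apply: eq_bigr => i _.
rewrite -big_split /=; apply: eq_bigr => j _.
by rewrite mcoeffD mulrDl monalgUD.
Qed.

Fact laurent_mulDr : right_distributive laurent_mul +%R.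
Proof. by move=> g f1 f2; rewrite laurent_mulC laurent_mulDl !(laurent_mulC g). Qed.

Fact laurent_mul0l : left_zero 0 laurent_mul.
Proof. by move=> g; rewrite /laurent_mul msupp0 big_seq_fset0. Qed.

Fact laurent_mul0r : right_zero 0 laurent_mul.
Proof. by move=> g; rewrite laurent_mulC laurent_mul0l. Qed.

Fact laurent_mul_suml (I : Type) (r : seq I) (F : I -> {malg K[int]}) g :
  laurent_mul (\sum_(i <- r) F i) g = \sum_(i <- r) laurent_mul (F i) g.
Proof.
exact: (big_morph (laurent_mul^~ g) (fun _ _ => laurent_mulDl _ _ _)
  (laurent_mul0l g)).
Qed.

Fact laurent_mul_sumr (I : Type) (r : seq I) (F : I -> {malg K[int]}) g :
  laurent_mul g (\sum_(i <- r) F i) = \sum_(i <- r) laurent_mul g (F i).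
Proof.
exact: (big_morph (laurent_mul g) (fun _ _ => laurent_mulDr _ _ _)
  (laurent_mul0r g)).
Qed.

Fact laurent_mulA : associative laurent_mul.
Proof.
move=> f g h; rewrite (monalgE f) !laurent_mul_suml; apply: eq_bigr => i _.
rewrite (monalgE g) laurent_mul_suml !laurent_mul_sumr laurent_mul_suml.
apply: eq_bigr => j _.
rewrite (monalgE h) !laurent_mul_sumr; apply: eq_bigr => k _.
by rewrite !laurent_mulUU mulrA addrA.
Qed.

Fact laurent_mul1l : left_id (<< 0 >> : {malg K[int]}) laurent_mul.
Proof.
move=> g; rewrite {1}(monalgE g) laurent_mul_sumr [RHS]monalgE.
by apply: eq_bigr => j _; rewrite laurent_mulUU mul1r add0r.
Qed.

Fact laurent_oner_neq0 : (<< 0 >> : {malg K[int]}) != 0.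
Proof. by rewrite monalgU_eq0 oner_eq0. Qed.

HB.instance Definition _ := GRing.Zmodule_isComNzRing.Build (laurent K)
  laurent_mulA laurent_mulC laurent_mul1l laurent_mulDl laurent_oner_neq0.

Fact laurent_scaleAl (c : K) (f g : laurent K) : c *: (f * g) = c *: f * g.
Proof.
have scaleE (u : {malg K[int]}) : c *: u = laurent_mul << c *g 0 >> u.
  apply/esym; rewrite {1}(monalgE u) laurent_mul_sumr; apply: eq_bigr => j _.
  by rewrite laurent_mulUU add0r.
rewrite [LHS]scaleE [in RHS]scaleE; exact: laurent_mulA.
Qed.

HB.instance Definition _ :=
  GRing.Lmodule_isLalgebra.Build K (laurent K) laurent_scaleAl.
HB.instance Definition _ := GRing.Lalgebra_isComAlgebra.Build K (laurent K).

End LaurentRing.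

Definition laurentX (K : fieldType) (n : int) : laurent K := << n >>.

Definition laurent_of_poly (K : fieldType) (p : {poly K}) : laurent K :=
  horner_alg (laurentX K 1) p.

Lemma laurentX0 (K : fieldType) : laurentX K 0 = 1.
Proof. by []. Qed.

Lemma laurentXD (K : fieldType) (m n : int) :
  laurentX K (m + n) = laurentX K m * laurentX K n.
Proof.
by rewrite -[RHS]/(laurent_mul _ _) laurent_mulUU mul1r.
Qed.

Definition is_LBP (K : fieldType) (l : nat) (P : nat -> {poly K})
    (L : {scalar (laurent K)}) : Prop :=
  (forall n, P n \is monic /\ size (P n) = n.+1) /\
  exists h : nat -> K,
    (forall n, h n != 0) /\
    (forall n k, (k <= n)%N ->
       L (laurent_of_poly (P n) * laurentX K (- (k * l)%:Z))
         = h n * (n == k)%:R).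

Section LatticePaths.
Variables (I : choiceType) (stp : I -> int * int).
Implicit Types (p q : int * int) (w : seq I).

Local Notation advance := (fun v i => v + stp i).

(* Paths are represented by their words; the initial point is kept separate.   *)
Definition path_end p w : int * int := foldl advance p w.

Definition path_vertices p w : seq (int * int) := p :: scanl advance p w.

Definition paths_between p q : set (seq I) :=
  [set w | path_end p w = q /\ all (fun v => 0 <= v.2) (path_vertices p w)]%classic.

Fixpoint path_weight (K : fieldType) (wt : I -> int * int -> K) p w : K :=
  if w is i :: w' then wt i p * path_weight wt (p + stp i) w' else 1.

End LatticePaths.

(* Steps are named by their index i in 0, .., l + 1; distinct indices have     *)
(* distinct step vectors as soon as l is positive.                             *)
Definition schroder_step (l : nat) (i : 'I_l.+2) : int * int :=
  if i == l.+1 :> nat then (1, -1) else (i%:Z, l%:Z - i%:Z).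

Definition dual_step (l : nat) (i : 'I_l.+2) : int * int :=
  if i == l.+1 :> nat then (l%:Z - 1, -1)
  else if i == l :> nat then (l%:Z, 0)
  else (l%:Z - i%:Z, l%:Z - i%:Z).

(* Steps of a path start at height >= 0, so `|v.2| is the height itself.       *)
Definition schroder_wt (K : fieldType) (l : nat) (a : nat -> nat -> K)
    (i : 'I_l.+2) (v : int * int) : K :=
  if i == 0 :> nat then 1 else a i `|v.2|%N.

Definition dual_wt (K : fieldType) (l : nat) (a : nat -> nat -> K)
    (i : 'I_l.+2) (v : int * int) : K :=
  let t := `|v.2|%N in
  if i == 0 :> nat then (-1) ^+ l.+1 / a l t
  else if i == l :> nat then (a l t)^-1
  else (-1) ^+ (l + 1 + i) * a i t / a l t.

Definition pathsB (l n : nat) : set (seq 'I_l.+2) :=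
  paths_between (@schroder_step l) (0, (n %% l)%N%:Z) (n%:Z, 0).

Definition pathsBdual (l n : nat) : set (seq 'I_l.+2) :=
  paths_between (@dual_step l) (0, (- n%:Z %% l%:Z)%Z) (n%:Z, 0).

Arguments pathsB l n : clear implicits.
Arguments pathsBdual l n : clear implicits.

Definition wB (K : fieldType) (l : nat) (a : nat -> nat -> K) (n : nat) : K :=
  \sum_(w \in pathsB l n)
    path_weight (@schroder_step l) (@schroder_wt K l a) (0, (n %% l)%N%:Z) w.

Definition wBdual (K : fieldType) (l : nat) (a : nat -> nat -> K) (n : nat) : K :=
  \sum_(w \in pathsBdual l n)
    path_weight (@dual_step l) (@dual_wt K l a) (0, (- n%:Z %% l%:Z)%Z) w.

(* The sums above range over finite sets, so that [\sum_(_ \in _)], which is 0 *)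
(* on an infinite support, is the usual sum.                                   *)
Lemma finite_paths_between (I : finType) (stp : I -> int * int) (c : int)
    (p q : int * int) :
  (forall i, 1 <= 2 * (stp i).1 + c * (stp i).2) ->
  finite_set (paths_between stp p q).
Proof.
move=> cost_ge1.
pose cost (v : int * int) : int := 2 * v.1 + c * v.2.
have costD (u v : int * int) : cost (u + v) = cost u + cost v by rewrite /cost /= !mulrDr addrACA.
have size_le w : (size w)%:Z + cost p <= cost (path_end stp p w).
  elim: w p => [|i w IHw] v /=; first by rewrite add0r.
  apply: le_trans (IHw _); rewrite costD.
  by rewrite intS [1 + _]addrC -addrA lerD2l addrC lerD2l cost_ge1.
pose N := `|cost q - cost p|%N.
apply: (@sub_finite_set _ _
  (\bigcup_(k in `I_N.+1) range (@tval k I))%classic).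
  move=> w [ew _]; exists (size w) => /=; last by exists (in_tuple w).
  have := size_le w; rewrite ew -lerBrDr => le_wN.
  by rewrite ltnS -lez_nat; apply: le_trans le_wN _; rewrite abszE ler_norm.
by apply: bigcup_finite => [|k _]; [exact: finite_II | exact/finite_image/finite_finset].
Qed.

Lemma finite_pathsB (l n : nat) : (0 < l)%N -> finite_set (pathsB l n).
Proof.
move=> l_gt0; apply: (@finite_paths_between _ _ 1) => i; rewrite /schroder_step.
by have := ltn_ord i; case: ifP => /=; lia.
Qed.

Lemma finite_pathsBdual (l n : nat) : (0 < l)%N -> finite_set (pathsBdual l n).
Proof.
move=> l_gt0; apply: (@finite_paths_between _ _ (-1)) => i; rewrite /dual_step.
by have := ltn_ord i; case: ifP => /=; [lia|case: ifP => /=; lia].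
Qed.

(* Main.v *)
(* Put G(m, t) = L[x^(ml) P_t].  Applied to x^(ml) times the recurrence for    *)
(* P_(t+l), the functional L gives a linear relation between values of G.      *)
(* Solved for G(m+1, t), it is, up to the factor a_(l,0), the first-step       *)
(* decomposition of weighted l-Schroder paths starting at height t; solved for *)
(* G(m, t), it is, up to the sign (-1)^t, the one of dual l-Schroder paths.    *)
(* The boundary conditions are G(0, 0) = 1 and, by orthogonality, G(-k, t) = 0 *)
(* for k < t; the moments are the values of G at heights t < l, where          *)
(* P_t = x^t.                                                                  *)

Require Import Defs.
From mathcomp Require Import all_boot all_order all_algebra.
From mathcomp Require Import finmap classical_sets cardinality.
From mathcomp Require Import fsbigop zify ring.

Import Order.TTheory GRing.Theory Num.Theory.

Local Open Scope ring_scope.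

(** Writing n = ml + r with 0 <= r < l gives L[x^n] = G(m, r), since P_r = x^r. The recurrence for P
    links the rows m and m + 1 of G, and removing the first step of a path ([path_sum_step]) gives
    path sums towards a fixed endpoint the same linear relations. Such a system is solved by
    induction on m and on the height, so it suffices to compare boundary values: orthogonality makes
    G vanish outside a triangle, and linear forms that no step decreases ([path_sum_monotone]) make
    the corresponding path sums vanish. [schroder_expansion] thus computes the rows m >= 1 and
    [dual_schroder_expansion] the rows m <= 0. For 1 <= n < l orthogonality alone gives 0. *)

Lemma succzB1 (n : nat) : n.+1%:Z - 1 = n%:Z.
Proof. by rewrite intS addrC addKr. Qed.

(** * Path sums: first-step decomposition and vanishing *)

Lemma big_nat_eq0 (V : nmodType) (m n : nat) (F : nat -> V) :
  (forall i, (m <= i < n)%N -> F i = 0) -> \sum_(m <= i < n) F i = 0.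
Proof. by move=> F0; rewrite big_nat big1. Qed.

(** Words are sorted by their first letter, [ohead]. Finiteness of [A] matters: over an infinite
    support the left side would be 0 by default. *)
Lemma fsbig_seq_cons (I : finType) (V : nmodType) (A : set (seq I))
    (F : seq I -> V) :
  finite_set A ->
  \sum_(w \in A) F w =
    (if [::] \in A then F [::] else 0) +
    \sum_(i : I) \sum_(w \in (cons i @^-1` A)%classic) F (i :: w).
Proof.
move=> finA; rewrite fsbig_finite // (partition_big ohead xpredT) //=.
rewrite (bigD1 None) //=; congr (_ + _).
  case: ifP => [A0|nA0].
    rewrite big_mkcond (bigD1_seq [::]) ?fset_uniq ?in_fset_set //=.
    by rewrite big1 ?addr0 // => -[].
  rewrite big_seq_cond big_pred0 // => -[|i w]; rewrite ?andbF //.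
  by rewrite in_fset_set // nA0.
rewrite (reindex_omap Some id) => [|[]] //=.
apply: eq_big => [i|i _]; rewrite ?eqxx //.
have finAi : finite_set (cons i @^-1` A)%classic.
  by apply: finite_preimage => // ? ? _ _ [].
rewrite fsbig_finite // -big_filter -(big_map (cons i) xpredT F).
apply: perm_big; apply: uniq_perm.
- by rewrite filter_uniq ?fset_uniq.
- by rewrite map_inj_uniq ?fset_uniq // => ? ? [].
move=> [|j w]; rewrite mem_filter /=.
  by apply/esym/negP => /mapP[].
have -> : (j :: w \in [seq i :: x | x <- fset_set (cons i @^-1` A)%classic]) =
          (j == i) && (w \in fset_set (cons i @^-1` A)%classic).
  apply/mapP/andP => [[x xA [-> ->]]|[/eqP-> xA]]; first by [].
  by exists w.
rewrite -[Some j == Some i]/(j == i); case: eqP => //= ->.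
by rewrite !in_fset_set //; apply/idP/idP; rewrite !inE.
Qed.

Section PathSums.
Variables (I : finType) (K : fieldType).
Variables (stp : I -> int * int) (wt : I -> int * int -> K) (q : int * int).
Implicit Types p : int * int.

Definition path_sum p : K :=
  \sum_(w \in paths_between stp p q) path_weight stp wt p w.

(** The empty word contributes only at [p = q]. Since [p] lies on or above the axis, dropping it
    from the vertices of a nonempty path leaves exactly the condition on the tail. *)
Lemma path_sum_step p :
  finite_set (paths_between stp p q) -> 0 <= p.2 ->
  path_sum p = (p == q)%:R + \sum_i wt i p * path_sum (p + stp i).
Proof.
move=> fin p_ge0; rewrite /path_sum fsbig_seq_cons //; congr (_ + _).
  case: ifPn => [|nE].
    by rewrite inE => -[/= <- _]; rewrite eqxx.
  case: eqP => // epq; case/negP: nE; rewrite inE /paths_between /= epq.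
  by rewrite -epq p_ge0.
apply: eq_bigr => i _; rewrite mulr_fsumr; apply: eq_fsbigl.
by apply/seteqP; split=> w; rewrite /paths_between /= p_ge0.
Qed.

Lemma path_sum_below p : p.2 < 0 -> path_sum p = 0.
Proof.
by move=> p_lt0; apply: fsbig1 => w [_ /andP[]]; rewrite leNgt p_lt0.
Qed.

(** The form c x + d y cannot decrease along a path, so an endpoint with a smaller value is
    unreachable. *)
Lemma path_sum_monotone (c d : int) p :
  (forall i, 0 <= c * (stp i).1 + d * (stp i).2) ->
  c * q.1 + d * q.2 < c * p.1 + d * p.2 -> path_sum p = 0.
Proof.
move=> mono lt_qp; apply: fsbig1 => w [ew _].
suff le_pe : c * p.1 + d * p.2
    <= c * (path_end stp p w).1 + d * (path_end stp p w).2.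
  by rewrite ew leNgt lt_qp in le_pe.
elim: w p {lt_qp ew} => [|i w IHw] p //=; apply: le_trans (IHw _).
by rewrite /= !mulrDr addrACA lerDl.
Qed.

End PathSums.

Arguments path_sum {I K} stp wt q p.
Arguments path_sum_below {I K stp wt q p}.
Arguments path_sum_monotone {I K stp wt q} c d {p}.

(** * First-step relations for the two families of paths *)

Lemma addpE (U V : nmodType) (x x' : U) (y y' : V) :
  (x, y) + (x', y') = (x + x', y + y').
Proof. by []. Qed.

(** The height [t%:Z - 1] stays in [int]: at t = 0 it is -1, where path sums vanish just as P_(-1)
    does. *)
Lemma schroder_path_sum_step (K : fieldType) (l : nat) (a : nat -> nat -> K)
    (q : int * int) (s : int) (t : nat) :
  (0 < l)%N ->
  let S := path_sum (@schroder_step l) (@schroder_wt K l a) q in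
  S (s, t%:Z) = ((s, t%:Z) == q)%:R + (S (s, (t + l)%N%:Z)
    + \sum_(1 <= i < l) a i t * S (s + i%:Z, (t + l - i)%N%:Z)
    + a l t * S (s + l%:Z, t%:Z) + a l.+1 t * S (s + 1, t%:Z - 1)).
Proof.
move=> l_gt0 S; rewrite {1}/S path_sum_step //; last first.
  (* Every step increases 2x + y by at least 1; for dual paths the form is 2x - y. *)
  apply: (@finite_paths_between _ _ 1) => i; rewrite /schroder_step.
  by have := ltn_ord i; case: ifP => /=; lia.
congr (_ + _).
(* Extending the summand from ordinals to [nat] allows the indices 0, l and l + 1 to be peeled
   off. *)
pose f (i : nat) : K :=
  (if i == 0%N then 1 else a i t) *
  S ((s, t%:Z) + (if i == l.+1 then (1, -1) else (i%:Z, l%:Z - i%:Z))).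
rewrite -[LHS]/(\sum_(i < l.+2) f i) -(big_mkord xpredT f).
rewrite big_nat_recr // big_nat_recr // big_ltn //.
have fE i : (i <= l)%N ->
    f i = (if i == 0%N then 1 else a i t) * S (s + i%:Z, (t + l - i)%N%:Z).
  move=> le_il; have ne_il : (i == l.+1) = false by rewrite ltn_eqF.
  by rewrite /f ne_il addpE; congr (_ * S (_, _)); lia.
rewrite -[LHS]/(f 0%N + \sum_(1 <= i < l) f i + f l + f l.+1).
congr (_ + _ + _ + _).
- by rewrite fE //= mul1r addr0 subn0.
- apply: eq_big_nat => i /andP[i_gt0 /ltnW le_il].
  by rewrite fE // gtn_eqF.
- by rewrite fE // gtn_eqF // addnK.
by rewrite /f eqxx addpE.
Qed.

Lemma dual_path_sum_step (K : fieldType) (l : nat) (a : nat -> nat -> K)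
    (q : int * int) (s : int) (t : nat) :
  (0 < l)%N ->
  let S := path_sum (@dual_step l) (@dual_wt K l a) q in
  S (s, t%:Z) = ((s, t%:Z) == q)%:R
    + ((-1) ^+ l.+1 * S (s + l%:Z, (t + l)%N%:Z)
    + \sum_(1 <= i < l)
        (-1) ^+ (l + 1 + i) * a i t * S (s + l%:Z - i%:Z, (t + l - i)%N%:Z)
    + S (s + l%:Z, t%:Z) + a l.+1 t * S (s + l%:Z - 1, t%:Z - 1)) / a l t.
Proof.
move=> l_gt0 S; rewrite {1}/S path_sum_step //; last first.
  apply: (@finite_paths_between _ _ (-1)) => i; rewrite /dual_step.
  by have := ltn_ord i; case: ifP => /=; [lia|case: ifP => /=; lia].
congr (_ + _).
pose f (i : nat) : K :=
  (if i == 0%N then (-1) ^+ l.+1 / a l t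
   else if i == l then (a l t)^-1 else (-1) ^+ (l + 1 + i) * a i t / a l t) *
  S ((s, t%:Z) + (if i == l.+1 then (l%:Z - 1, -1)
                  else if i == l then (l%:Z, 0)
                  else (l%:Z - i%:Z, l%:Z - i%:Z))).
rewrite -[LHS]/(\sum_(i < l.+2) f i) -(big_mkord xpredT f).
rewrite big_nat_recr // big_nat_recr // big_ltn // !mulrDl mulr_suml.
have fE i : (i < l)%N -> f i =
    (if i == 0%N then (-1) ^+ l.+1 / a l t
     else (-1) ^+ (l + 1 + i) * a i t / a l t)
    * S (s + l%:Z - i%:Z, (t + l - i)%N%:Z).
  move=> lt_il; have ne_il : (i == l.+1) = false by rewrite ltn_eqF // ltnW.
  by rewrite /f (ltn_eqF lt_il) ne_il addpE; congr (_ * S (_, _)); lia.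
rewrite -[LHS]/(f 0%N + \sum_(1 <= i < l) f i + f l + f l.+1).
congr (_ + _ + _ + _).
- by rewrite fE //= subr0 subn0 mulrAC.
- apply: eq_big_nat => i /andP[i_gt0 lt_il].
  by rewrite fE // gtn_eqF // mulrAC.
- rewrite /f gtn_eqF // eqxx ifF ?ltn_eqF // addpE mulrC; congr (S (_, _) * _).
  by rewrite addr0.
have -> : f l.+1 = (-1) ^+ (l + 1 + l.+1) * a l.+1 t / a l t
                   * S (s + (l%:Z - 1), t%:Z - 1).
  by rewrite /f eqxx (gtn_eqF (ltnSn l)).
by rewrite -signr_odd addn1 oddD addbb mul1r addrA mulrAC.
Qed.

(** * Values of G as path sums *)

Section PathExpansion.
Variables (K : fieldType) (l : nat) (a : nat -> nat -> K) (G : int -> int -> K).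
Hypothesis l_gt0 : (0 < l)%N.
Hypothesis G_rec : forall (m : int) (t : nat),
  G (m + 1) t = G m (t + l)%N + \sum_(1 <= i < l) a i t * G m (t + l - i)%N
    + a l t * G m t + a l.+1 t * G (m + 1) (t%:Z - 1).
Hypothesis G_m1 : forall m, G m (-1) = 0.
Hypothesis G_00 : G 0 0 = 1.
Hypothesis G_triangular : forall k t : nat, (k < t)%N -> G (- k%:Z) t = 0.

(* The quantity s + t is constant along a_(l+1) and grows by l along the other *)
(* steps, so m counts the steps still to be made that are not a_(l+1).         *)
Lemma schroder_expansion (n m t : nat) (s : int) :
  s + t%:Z + (m * l)%N%:Z = n%:Z ->
  G (m%:Z + 1) t = a l 0%N
    * path_sum (@schroder_step l) (@schroder_wt K l a) (n%:Z, 0) (s, t%:Z).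
Proof.
set S := path_sum _ _ _.
have S_far (s' t' : int) : n%:Z < s' + t' -> S (s', t') = 0.
  move=> lt_n; apply: (path_sum_monotone 1 1) => [i|]; last by rewrite /=; lia.
  by rewrite /schroder_step; case: ifP => _ /=; lia.
have S_m1 s' : S (s', 0%N%:Z - 1) = 0 by exact: path_sum_below.
have S_step (s' : int) (t' : nat) :=
  schroder_path_sum_step K l a (n%:Z, 0) s' t' l_gt0.
rewrite -/S in S_step; clearbody S.
have G_0B1 m' : G m' (0%N%:Z - 1) = 0 by exact: G_m1.
have G_0 t' : (0 < t')%N -> G 0 t'%:Z = 0 by exact: (G_triangular 0).
elim: m t s => [|m IHm] t.
  elim: t => [|t IHt] s stE; rewrite G_rec S_step.
(* In row 0 only G(0, 0) = 1 survives, with coefficient a_(l,0): this is the origin of the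
   prefactor. On the path side only the empty path remains. *)
- rewrite S_m1 G_0B1 !mulr0 !addr0 G_0 ?addn_gt0 ?l_gt0 // G_00.
  rewrite (S_far s (0 + l)%N); last lia.
  rewrite (S_far (s + l%:Z)) ?mulr0 ?addr0; last lia.
  rewrite !big_nat_eq0 ?addr0 ?add0r.
  + have -> : s = n%:Z by lia.
    by rewrite eqxx.
  + by move=> i lt_il; rewrite S_far ?mulr0 //; lia.
  + by move=> i lt_il; rewrite G_0 ?mulr0 //; lia.
- rewrite !G_0 ?addn_gt0 ?l_gt0 ?orbT //.
  rewrite (S_far s (t.+1 + l)%N); last lia.
  rewrite (S_far (s + l%:Z)) ?mulr0 ?addr0; last lia.
  rewrite xpair_eqE andbF add0r succzB1 (IHt (s + 1)); last lia.
  rewrite !big_nat_eq0 ?add0r.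
  + by rewrite mulrCA.
  + by move=> i lt_il; rewrite S_far ?mulr0 //; lia.
  + by move=> i lt_il; rewrite G_0 ?mulr0 //; lia.
have IHm1 t' s' : s' + t'%:Z + (m * l)%N%:Z = n%:Z ->
    G m.+1 t' = a l 0%N * S (s', t'%:Z).
  by move=> /IHm <-; rewrite -addn1 PoszD.
(* The step a_(l+1) keeps m but lowers t, hence an inner induction on t. *)
elim: t => [|t IHt] s stE; rewrite G_rec S_step.
- rewrite S_m1 G_0B1 !mulr0 !addr0 xpair_eqE.
  rewrite andbC /=; case: eqP => [|_]; first nia.
  rewrite add0r !mulrDr mulr_sumr; congr (_ + _ + _).
  + by apply: IHm1; lia.
  + apply: eq_big_nat => i lt_il; rewrite mulrCA; congr (_ * _).
    by apply: IHm1; lia.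
  by rewrite mulrCA; congr (_ * _); apply: IHm1; lia.
rewrite xpair_eqE andbF add0r !mulrDr mulr_sumr succzB1; congr (_ + _ + _ + _).
- by apply: IHm1; lia.
- apply: eq_big_nat => i lt_il; rewrite mulrCA; congr (_ * _).
  by apply: IHm1; lia.
- by rewrite mulrCA; congr (_ * _); apply: IHm1; lia.
by rewrite mulrCA; congr (_ * _); apply: IHt; lia.
Qed.

(* Only the steps A_l and A_(l+1) change s - t, each by l, so k counts the     *)
(* steps of these two kinds still to be made.                                  *)
Lemma dual_schroder_expansion (n k t : nat) (s : int) :
  (forall j, a l j != 0) -> s - t%:Z + (k * l)%N%:Z = n%:Z ->
  G (- k%:Z) t = (-1) ^+ t
    * path_sum (@dual_step l) (@dual_wt K l a) (n%:Z, 0) (s, t%:Z).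
Proof.
move=> al_neq0; set S := path_sum _ _ _.
have S_far (s' t' : int) : n%:Z < s' - t' -> S (s', t') = 0.
  move=> lt_n; apply: (path_sum_monotone 1 (-1)) => [i|].
    2: by rewrite /=; lia.
  by rewrite /dual_step; case: ifP => _ /=; [lia|case: ifP => /=; lia].
(* No dual step decreases s + (l - 1)t. Given s - t + kl = n, the condition reads k < t, the same
   range as in [G_triangular]. *)
have S_high (s' t' : int) : n%:Z - s' + t' < l%:Z * t' -> S (s', t') = 0.
  move=> lt_n; apply: (path_sum_monotone 1 (l%:Z - 1)) => [i|].
    rewrite /dual_step; have lt_i := ltn_ord i.
    case: ifP => [_ /=|/negbT ne_i]; first lia.
    case: ifP => _ /=; first lia.
    by rewrite -mulrDl mulr_ge0 //; lia.
  by rewrite /=; lia.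
have S_m1 s' : S (s', 0%N%:Z - 1) = 0 by exact: path_sum_below.
have S_step (s' : int) (t' : nat) :=
  dual_path_sum_step K l a (n%:Z, 0) s' t' l_gt0.
rewrite -/S in S_step; clearbody S.
have G_0B1 m' : G m' (0%N%:Z - 1) = 0 by exact: G_m1.
elim: k t s => [|k IHk] t s stE.
  have S_0 (t' : nat) s' : (0 < t')%N -> s' - t'%:Z = n%:Z -> S (s', t'%:Z) = 0.
    move=> t'_gt0 st'E; apply: S_high.
    have : (0 < l * t')%N by rewrite muln_gt0 l_gt0.
    by lia.
  case: t stE => [|t] stE; last by rewrite G_triangular // S_0 ?mulr0 //; lia.
  rewrite oppr0 G_00 S_step S_m1 (S_0 (0 + l)%N); [|by []|lia].
  rewrite (S_far (s + l%:Z)); last lia.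
  rewrite big_nat_eq0 => [|i lt_il]; last by rewrite S_0 ?mulr0 //; lia.
  have -> : s = n%:Z by lia.
  by rewrite eqxx !mulr0 !addr0 mul0r addr0 mul1r.
(* The steps A_i with i < l keep k and raise t, so row k + 1 is solved downwards in t, starting from
   t > k + 1, where both sides vanish. *)
have [d] := ubnP (k.+2 - t)%N; elim: d => // d IHd in t s stE *.
move=> lt_d; have [lt_kt|le_tk] := ltnP k.+1 t.
  rewrite G_triangular // S_high ?mulr0 //.
  have : (k.+1 * l < l * t)%N by rewrite mulnC ltn_pmul2l.
  by lia.
(* This parity explains the signs of the dual weights: they absorb the change of (-1)^t between the
   heights t and t + l - i. *)
have sgn i : (i <= l)%N ->
    (-1) ^+ (t + l - i) = - ((-1) ^+ t * (-1) ^+ (l + 1 + i)) :> K.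
  move=> le_il; rewrite -exprD -[RHS]mulN1r -exprS -signr_odd -[RHS]signr_odd.
  by congr (_ ^+ nat_of_bool _); lia.
have G_low : G (- k%:Z) (t%:Z - 1)
    = - ((-1) ^+ t * S (s + l%:Z - 1, t%:Z - 1)).
  case: t stE {le_tk lt_d sgn} => [|t] stE.
    by rewrite G_0B1 S_m1 mulr0 oppr0.
  rewrite succzB1 (IHk _ (s + l%:Z - 1)); last lia.
  by rewrite exprS mulN1r mulNr opprK.
have sub1 : - k.+1%:Z + 1 = - k%:Z by lia.
have := G_rec (- k.+1%:Z) t; rewrite sub1 G_low (IHk _ (s + l%:Z)); last lia.
rewrite (IHd (t + l)%N (s + l%:Z)); [|lia|lia].
have -> : \sum_(1 <= i < l) a i t * G (- k.+1%:Z) (t + l - i)%N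
    = - ((-1) ^+ t * \sum_(1 <= i < l)
        (-1) ^+ (l + 1 + i) * a i t * S (s + l%:Z - i%:Z, (t + l - i)%N%:Z)).
  rewrite mulr_sumr -sumrN; apply: eq_big_nat => i lt_il.
  rewrite (IHd _ (s + l%:Z - i%:Z)); [|lia|lia].
  by rewrite sgn; [ring|lia].
have -> : (-1) ^+ (t + l) = - ((-1) ^+ t * (-1) ^+ l.+1) :> K.
  by have := sgn 0%N isT; rewrite subn0 addn0 addn1.
move=> recG.
have ne_q : ((s, t%:Z) == (n%:Z, 0)) = false by apply/eqP => -[]; nia.
rewrite S_step ne_q; apply: (mulfI (al_neq0 t)).
rewrite add0r mulrCA [a l t * (_ / _)]mulrC divfK //.
rewrite !mulrDr recG; ring.
Qed.

End PathExpansion.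

(** * From the functional to G and the moments *)

Lemma laurent_of_polyXn (K : fieldType) (n : nat) :
  laurent_of_poly ('X^n : {poly K}) = laurentX K n%:Z.
Proof.
rewrite /laurent_of_poly rmorphXn /= horner_algX.
by elim: n => // n IHn; rewrite exprS IHn -laurentXD.
Qed.

Theorem theorem3p2 (l : nat) (hl : (0 < l)%N) (K : fieldType)
    (a : nat -> nat -> K)
    (ha_l : forall j : nat, a l j != 0)
    (ha_l1 : forall j : nat, a l.+1 j != 0)
    (P : int -> {poly K})
    (hPm1 : P (-1) = 0)
    (hPinit : forall n : nat, (n < l)%N -> P n%:Z = 'X^n)
    (hPrec : forall n : nat, (l <= n)%N ->
       P n%:Z =
         - \sum_(1 <= i < l) a i (n - l)%N *: P (n%:Z - i%:Z)
         + ('X^l - (a l (n - l)%N)%:P) * P (n%:Z - l%:Z)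
         - a l.+1 (n - l)%N *: ('X^l * P (n%:Z - l%:Z - 1)))
    (L : {scalar (laurent K)})
    (hLBP : is_LBP l (fun n : nat => P n%:Z) L)
    (hL1 : L 1 = 1) :
  forall n : int,
    [/\ l%:Z <= n -> L (laurentX K n) = a l 0%N * wB l a (absz (n - l%:Z)%R),
        1 <= n <= l%:Z - 1 -> L (laurentX K n) = 0
      & n <= 0 ->
        L (laurentX K n) = (-1) ^ (n %% l%:Z)%Z * wBdual l a `|n|%N].
Proof.
have [_ [h [_ orth]]] := hLBP.
pose phi (m : int) (p : {poly K}) :=
  L (laurent_of_poly p * laurentX K (m * l%:Z)).
have phiD m p q : phi m (p + q) = phi m p + phi m q.
  by rewrite /phi /laurent_of_poly rmorphD mulrDl linearD.
have phiZ m c p : phi m (c *: p) = c * phi m p.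
  rewrite /phi /laurent_of_poly -mul_polyC rmorphM /= horner_algC mulr_algl.
  by rewrite -scalerAl linearZ.
have phi0 m : phi m 0 = 0.
  by rewrite /phi /laurent_of_poly rmorph0 mul0r linear0.
have phiXl (m : int) p : phi (m + 1) p = phi m ('X^l * p).
  rewrite /phi [laurent_of_poly ('X^l * p)]rmorphM /= -/(laurent_of_poly _).
  rewrite -/(laurent_of_poly p) laurent_of_polyXn mulrDl mul1r laurentXD.
  by rewrite mulrA mulrAC [X in X * _]mulrC.
pose G (m t : int) := phi m (P t).
have G_rec (m : int) (t : nat) :
  G (m + 1) t = G m (t + l)%N + \sum_(1 <= i < l) a i t * G m (t + l - i)%N
    + a l t * G m t + a l.+1 t * G (m + 1) (t%:Z - 1).
  (* The recurrence is solved for x^l P_t. The factor x^l on P_(t-1) puts that term in row m + 1. *)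
  have PE : 'X^l * P t%:Z = P (t + l)%N%:Z
      + \sum_(1 <= i < l) a i t *: P (t + l - i)%N%:Z
      + a l t *: P t%:Z + a l.+1 t *: ('X^l * P (t%:Z - 1)).
    rewrite (hPrec (t + l)%N) ?leq_addl // addnK PoszD addrK.
    have -> : \sum_(1 <= i < l) a i t *: P (t + l - i)%N%:Z
        = \sum_(1 <= i < l) a i t *: P (t%:Z + l%:Z - i%:Z).
      by apply: eq_big_nat => i lt_il; congr (_ *: P _); lia.
    by rewrite mulrBl mul_polyC; ring.
  rewrite /G !phiXl PE !phiD !phiZ (big_morph _ (phiD m) (phi0 m)).
  by congr (_ + _ + _ + _); apply: eq_bigr => i _; rewrite phiZ.
have G_m1 m : G m (-1) = 0 by rewrite /G hPm1 phi0.
have GX (m : int) (r : nat) : (r < l)%N ->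
    L (laurentX K (m * l%:Z + r%:Z)) = G m r.
  by move=> lt_rl; rewrite /G /phi hPinit // laurent_of_polyXn addrC laurentXD.
have G_00 : G 0 0 = 1 by rewrite -(GX 0 0%N) // laurentX0 hL1.
have G_triangular (k t : nat) : (k < t)%N -> G (- k%:Z) t = 0.
  move=> lt_kt; rewrite /G /phi mulNr -PoszM orth 1?ltnW //.
  by rewrite gtn_eqF // mulr0.
move=> n; have l_neq0 : l%:Z != 0 by lia.
pose r := `|(n %% l%:Z)%Z|%N.
have rE : (n %% l%:Z)%Z = r%:Z by rewrite /r gez0_abs // modz_ge0.
have lt_rl : (r < l)%N by rewrite -ltz_nat -rE ltz_pmod.
have nE : n = (n %/ l%:Z)%Z * l%:Z + r%:Z by rewrite -rE -divz_eq.
split=> [le_ln|n_bd|n_le0].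
(* With quotient m + 1, n - l = ml + r, so paths start at height r = (n - l) mod l. *)
- have [m mE] : exists m : nat, (n %/ l%:Z)%Z = m%:Z + 1.
    exists `|(n %/ l%:Z)%Z - 1|%N; rewrite gez0_abs ?subrK //.
    by rewrite subr_ge0; nia.
  rewrite nE mE GX // (@schroder_expansion K l a G hl G_rec G_m1 G_00
    G_triangular (m * l + r) m r 0); last lia.
  have -> : absz ((m%:Z + 1) * l%:Z + r%:Z - l%:Z)%R = (m * l + r)%N by lia.
  by rewrite /wB /pathsB modnMDl modn_small.
- have lt_nl : (`|n| < l)%N by lia.
  have -> : n = 0 * l%:Z + `|n|%N%:Z by lia.
  by rewrite GX // (G_triangular 0%N) //; lia.
(* Here |n| = kl - r, which is the invariant of the dual expansion at (s, t) = (0, r). *)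
have [k kE] : exists k : nat, (n %/ l%:Z)%Z = - k%:Z.
  by exists `|(n %/ l%:Z)%Z|%N; nia.
have n'E : - `|n|%N%:Z = n by lia.
rewrite {1}nE kE GX // (@dual_schroder_expansion K l a G hl G_rec G_m1 G_00
  G_triangular `|n|%N k r 0) //; last lia.
by rewrite /wBdual /pathsBdual n'E rE.
Qed.
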